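(* Let $R$ be a reduced divided commutative ring with $1\neq 0$ and let $I$ be a proper ideal of $R$. Then the following statements are equivalent. (1) $I$ is a weakly 1-absorbing primary ideal of $R$. (2) $I$ is a weakly primary ideal of $R$.
   Context: All rings are commutative with $1\neq 0$. A ring is reduced if it has no nonzero nilpotent elements. A ring $R$ is called divided if for every prime ideal $P$ of $R$ and every $x\in R\setminus P$, we have $x\mid p$ for every $p\in P$. For an ideal $I$ of $R$, $\sqrt{I}=\{a\in R : a^n\in I \text{ for some positive integer } n\}$. A proper ideal $I$ of $R$ is called weakly 1-absorbing primary if whenever $a,b,c\in R$ are nonunit elements and $0\neq abc\in I$, then $ab\in I$ or $c\in\sqrt{I}$. A proper ideal $I$ of $R$ is called weakly primary if whenever $a,b\in R$ and $0\neq ab\in I$, then $a\in I$ or $b\in\sqrt{I}$. *)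

(* Defs.v *)
From mathcomp Require Import all_boot all_algebra.
From mathcomp Require Import boolp classical_sets.

Set Implicit Arguments.
Unset Strict Implicit.
Unset Printing Implicit Defensive.

Import GRing.Theory.

Local Open Scope ring_scope.
Local Open Scope classical_set_scope.

(* Ideals are arbitrary (Prop-valued) sets I : set R, to which the predicates
   of ring_quotient.v are applied through mem; membership in mem I is I itself
   (in_setE).  Note that idealr_closed requires 1 \notin I, i.e. it describes
   proper ideals. *)

(* GRing.unit would require a comUnitRingType, i.e. a given boolean unit test. *)
Definition is_unit (R : comNzRingType) (x : R) : Prop := exists y, x * y = 1.

Definition divides (R : comNzRingType) (x p : R) : Prop := exists y, p = x * y.

Definition reduced_ring (R : comNzRingType) : Prop :=
  forall (x : R) (n : nat), x ^+ n = 0 -> x = 0.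

Definition prime_ideal (R : comNzRingType) (P : set R) : Prop :=
  idealr_closed (mem P) /\ prime_idealr_closed (mem P).

Definition divided_ring (R : comNzRingType) : Prop :=
  forall P : set R, prime_ideal P ->
  forall x, ~ P x -> forall p, P p -> divides x p.

Definition ideal_radical (R : comNzRingType) (I : set R) : set R :=
  [set a | exists2 n : nat, (0 < n)%N & I (a ^+ n)].

Definition weakly_1_absorbing_primary (R : comNzRingType) (I : set R) : Prop :=
  idealr_closed (mem I) /\
  forall a b c : R, ~ is_unit a -> ~ is_unit b -> ~ is_unit c ->
    a * b * c <> 0 -> I (a * b * c) -> I (a * b) \/ ideal_radical I c.

Definition weakly_primary (R : comNzRingType) (I : set R) : Prop :=
  idealr_closed (mem I) /\
  forall a b : R, a * b <> 0 -> I (a * b) -> I a \/ ideal_radical I b.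

(* Main.v *)
Require Import Defs.
From mathcomp Require Import all_boot all_algebra.
From mathcomp Require Import boolp classical_sets.
From mathcomp Require Import ring.

(** Let [a * b] be a nonzero element of [I] with [b] outside the radical of [I].
    Some prime [P] contains [I] but not [b], hence contains [a]; dividedness gives
    [a = b * k], where [k] is a nonunit since [b] is not in [P].  Absorption applied
    to [b * k * b = a * b] then yields [a = b * k] in [I]. *)

Import GRing.Theory.
Local Open Scope ring_scope.
Local Open Scope classical_set_scope.

Lemma idealr_closedE (R : comNzRingType) (J : set R) :
  idealr_closed (mem J) <->
  [/\ J 0, ~ J 1 & forall a u v, J u -> J v -> J (a * u + v)].
Proof.
split=> -[J0 J1 JL]; split.
- by move: J0; rewrite in_setE.
- by move=> /mem_set; apply/negP.
- by move=> a u v /mem_set Ju /mem_set Jv; apply: set_mem; apply: JL.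
- exact: mem_set.
- by apply/negP => /set_mem.
- by move=> a u v /set_mem Ju /set_mem Jv; apply: mem_set; apply: JL.
Qed.

Lemma idealr_mull (R : comNzRingType) (J : set R) (a u : R) :
  idealr_closed (mem J) -> J u -> J (a * u).
Proof. by case/idealr_closedE=> J0 _ JL Ju; rewrite -[a * u]addr0; apply: JL. Qed.

Lemma idealr_unit (R : comNzRingType) (J : set R) (u x : R) :
  idealr_closed (mem J) -> is_unit u -> J (u * x) -> J x.
Proof.
move=> idJ [v uv1] Jux.
have -> : x = v * (u * x) by rewrite mulrA [v * u]mulrC uv1 mul1r.
exact: idealr_mull.
Qed.

(** The multiplicative set avoided consists of all powers of [b], with [b ^+ 0 = 1] among them. *)
Definition ideal_avoiding_powers {R : comNzRingType} (b : R) (J : set R) : Prop :=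
  idealr_closed (mem J) /\ forall n, ~ J (b ^+ n).

(** Zorn's lemma: two elements of the union of a chain lie in a common member, so the union is again
    an ideal, and a power of [b] in it would lie in some member. *)
Lemma maximal_avoiding_powers (R : comNzRingType) (I : set R) (b : R) :
  ideal_avoiding_powers b I ->
  exists M, [/\ ideal_avoiding_powers b M, I `<=` M &
    forall J, ideal_avoiding_powers b J -> M `<=` J -> J = M].
Proof.
move=> avI.
(* The union with [I] makes the empty chain have an upper bound. *)
pose Q := [set X | ideal_avoiding_powers b (I `|` X)].
have [F FQ Ftot|A [QA maxA]] := @Zorn_bigcup R Q.
  (* Adjoining [set0] to [F] makes [I] itself a member of the chain, so an empty [F] needs no
     separate case. *)
  have Q0 X : (set0 |` F) X -> ideal_avoiding_powers b (I `|` X).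
    by case=> [->|/FQ //]; rewrite setU0.
  have inU x : (I `|` \bigcup_(X in F) X) x <->
      exists2 X, (set0 |` F) X & (I `|` X) x.
    split=> [[Ix|[X FX Xx]]|[X [->|FX] [Ix|Xx]]] //.
    + by exists set0; left.
    + by exists X; right.
    + by left.
    + by left.
    + by right; exists X.
  split; last by move=> n /inU[X /Q0[_ avX]]; apply: avX.
  have [/idealr_closedE[I0 I1 _] _] := avI.
  apply/idealr_closedE; split; first by left.
    by case/inU=> X /Q0[/idealr_closedE[]].
  move=> a u v /inU[X FX Xu] /inU[Y FY Yv]; apply/inU.
  have [sXY|sYX] : X `<=` Y \/ Y `<=` X.
    case: FX FY => [-> _|FX [->|FY]]; [by left|by right|exact: Ftot].
  + exists Y => //; have [/idealr_closedE[_ _ YL] _] := Q0 _ FY.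
    by apply: YL => //; apply: setUS Xu.
  + exists X => //; have [/idealr_closedE[_ _ XL] _] := Q0 _ FX.
    by apply: XL => //; apply: setUS Yv.
exists (I `|` A); split=> // J avJ sAJ.
have QJ : Q J.
  by rewrite /Q /= setUidr // => x Ix; apply: sAJ; left.
(* A point of [J] outside [A] would make [J] a strictly larger member of [Q]. *)
apply/seteqP; split=> // x Jx; right; apply: contrapT => nAx.
apply: (maxA J) QJ; split; first by move=> y Ay; apply: sAJ; right.
by move=> /(_ x Jx).
Qed.

(** The ideal [M + R u] is strictly larger than [M], so by maximality it meets the powers of [b]. *)
Lemma maximal_avoiding_powers_adjoin (R : comNzRingType) (M : set R) (b u : R) :
  ideal_avoiding_powers b M ->
  (forall J, ideal_avoiding_powers b J -> M `<=` J -> J = M) ->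
  ~ M u -> exists n r m, M m /\ b ^+ n = m + r * u.
Proof.
move=> [/idealr_closedE[M0 M1 ML] _] maxM nMu; apply: contrapT => npow.
pose J := [set x | exists r m, M m /\ x = m + r * u].
have avJ n : ~ J (b ^+ n) by move=> [r [m ?]]; apply: npow; exists n, r, m.
apply: nMu; rewrite -(maxM J); first by exists 1, 0; split=> //; ring.
  split=> //; apply/idealr_closedE; split; last 1 first.
  - move=> a _ _ [r [m [Mm ->]]] [s [n [Mn ->]]].
    by exists (a * r + s), (a * m + n); split; [exact: ML|ring].
  - by exists 0, 0; split=> //; ring.
  (* Properness of [J] is avoidance at exponent 0. *)
  - by have := avJ 0; rewrite expr0.
by move=> x Mx; exists 0, x; split=> //; ring.
Qed.

(** Krull's argument: an ideal maximal among those avoiding the powers of [b] is prime. *)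
Lemma prime_ideal_notin_radical (R : comNzRingType) (I : set R) (b : R) :
  idealr_closed (mem I) -> ~ ideal_radical I b ->
  exists P, [/\ prime_ideal P, I `<=` P & ~ P b].
Proof.
move=> idI nIb.
have [|M [avM sIM maxM]] := @maximal_avoiding_powers R I b.
  (* The radical only speaks of positive exponents; exponent 0 is excluded by [1] not being in
     [I]. *)
  split=> // -[|n] Ibn; last by apply: nIb; exists n.+1.
  by case/idealr_closedE: idI => _ I1 _; apply: I1; rewrite -(expr0 b).
have [idM nMb] := avM; have [_ _ ML] := (idealr_closedE R M).1 idM.
exists M; split=> //; last by rewrite -(expr1 b).
split=> // u v /set_mem Muv; apply/orP; apply: contrapT => nMuv.
have [n [r [m [Mm En]]]] : exists n r m, M m /\ b ^+ n = m + r * u.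
  apply: maximal_avoiding_powers_adjoin => // Mu.
  by apply: nMuv; left; apply: mem_set.
have [k [s [p [Mp Ek]]]] : exists n r m, M m /\ b ^+ n = m + r * v.
  apply: maximal_avoiding_powers_adjoin => // Mv.
  by apply: nMuv; right; apply: mem_set.
(* In the product of the two powers every term has a factor [m], [p] or [u * v], all in [M]. *)
apply: (nMb (n + k)%N); rewrite exprD En Ek.
have -> : (m + r * u) * (p + s * v) =
          (p + s * v) * m + ((r * u) * p + (r * s) * (u * v)) by ring.
by apply: (ML) => //; apply: ML => //; apply: idealr_mull.
Qed.

Theorem theorem7 (R : comNzRingType) (I : set R)
  (hred : reduced_ring R) (hdiv : divided_ring R)
  (hI : idealr_closed (mem I)) :
  weakly_1_absorbing_primary I <-> weakly_primary I.
Proof.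
split=> [[_ absI]|[_ primI]]; split=> //; last first.
  (* The weakly primary condition is applied to the factors [a * b] and [c]. *)
  by move=> a b c _ _ _; apply: primI.
move=> a b ab0 Iab.
have [|nIb] := pselect (ideal_radical I b); [by right|left].
(* Absorption requires nonunits; a unit [b] can be cancelled from [a * b]. *)
have [ub|nub] := pselect (is_unit b).
  by apply: idealr_unit ub _ => //; rewrite mulrC.
have [P [[idP primeP] sIP nPb]] := prime_ideal_notin_radical _ _ _ hI nIb.
have Pa : P a.
  by case/orP: (primeP a b (mem_set (sIP _ Iab))) => /set_mem.
have [k Ea] := hdiv P (conj idP primeP) b nPb a Pa.
have nuk : ~ is_unit k.
  by move=> uk; apply: nPb; apply: idealr_unit uk _ => //; rewrite mulrC -Ea.
by case: (absI b k b nub nuk nub); rewrite -?Ea.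
Qed.
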